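(* Let $a,b>0$ and $c_1,c_2\ge0$ with $c_1^2+c_2^2\ne0$. Let $F:\mathbb{R}^m\times\mathbb{R}^m\to\mathbb{R}$ be a continuously Fréchet differentiable function which satisfies the Kurdyka-Łojasiewicz property at some point $z^*=(x^*,x^* )\in\mathbb{R}^m\times\mathbb{R}^m$, and let $U$, $\eta$ and $\varphi:[0,\eta)\to[0,+\infty)$ be the objects appearing in the definition of the KL property of $F$ at $z^*$. Let $\sigma>\rho>0$ be such that $B(z^*,\sigma)\subseteq U$. Let $(x_n)_{n\in\mathbb{N}},(v_n)_{n\in\mathbb{N}},(w_n)_{n\in\mathbb{N}}$ be sequences in $\mathbb{R}^m$ and let $(z_n)_{n\in\mathbb{N}}=(v_n,w_n)_{n\in\mathbb{N}}\subseteq\mathbb{R}^m\times\mathbb{R}^m$ satisfy: (H1) for each $n\in\mathbb{N}$, $a\|x_{n+1}-x_n\|^2\le F(z_n)-F(z_{n+1})$; (H2) for each $n\in\mathbb{N}$, $n\ge1$, $\|\nabla F(z_n)\|\le b(\|x_{n+1}-x_n\|+\|x_n-x_{n-1}\|)$; (H3) for each $n\in\mathbb{N}$, $n\ge1$, and every $z=(x,x)\in\mathbb{R}^m\times\mathbb{R}^m$, $\|z_n-z\|\le c_1\|x_n-x\|+c_2\|x_{n-1}-x\|$. Assume further that for all $n\in\mathbb{N}$, $$z_n\in B(z^*,\rho)\implies z_{n+1}\in B(z^*,\sigma)\ \text{ and }\ F(z_{n+1})\ge F(z^* ).$$ Moreover, assume that $z_0\in B(z^*,\rho)$, $F(z^*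 )\le F(z_0)<F(z^* )+\eta$ and $$\|x^*-x_0\|+2\sqrt{\frac{F(z_0)-F(z^* )}{a}}+\frac{9b}{4a}\varphi(F(z_0)-F(z^* ))<\frac{\rho}{c_1+c_2}.$$ Then: $z_n\in B(z^*,\rho)$ for all $n\in\mathbb{N}$; $\sum_{n=1}^{+\infty}\|x_n-x_{n-1}\|<+\infty$ and $(x_n)_{n\in\mathbb{N}}$ converges to a point $\overline{x}\in\mathbb{R}^m$; the sequence $(z_n)_{n\in\mathbb{N}}$ converges to $\overline{z}=(\overline{x},\overline{x})$; moreover $\overline{z}\in B(z^*,\sigma)$, $\nabla F(\overline{z})=0$, and $F(z_n)\to F(\overline{z})=F(z^* )$ as $n\to+\infty$.
   Context: $\mathbb{N}=\{0,1,2,\dots\}$; $\|\cdot\|$ is the Euclidean norm ($\mathbb{R}^m\times\mathbb{R}^m$ carries the Euclidean norm of $\mathbb{R}^{2m}$); $B(z,r)$ is the open ball with center $z$ and radius $r$. Kurdyka-Łojasiewicz (KL) property. For $\eta\in(0,+\infty]$, $\Theta_\eta$ denotes the class of concave and continuous functions $\varphi:[0,\eta)\to[0,+\infty)$ such that $\varphi(0)=0$, $\varphi$ is continuously differentiable on $(0,\eta)$, continuous at $0$, and $\varphi'(t)>0$ for all $t\in(0,\eta)$. A differentiable function $f:\mathbb{R}^d\to\mathbb{R}$ satisfies the KL property at $\overline{x}\in\mathbb{R}^d$ if there exist $\eta\in(0,+\infty]$, a neighborhood $U$ of $\overline{x}$ and $\varphi\in\Theta_\eta$ such that for all $x\in U\cap\{x\in\mathbb{R}^d: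 f(\overline{x})<f(x)<f(\overline{x})+\eta\}$ one has $\varphi'(f(x)-f(\overline{x}))\|\nabla f(x)\|\ge 1$. *)

(* Defs.v *)
From HB Require Import structures.
From mathcomp Require Export all_boot all_order all_algebra.
From mathcomp Require Export all_classical all_reals all_analysis.
Export Order.TTheory GRing.Theory Num.Theory.
Export numFieldNormedType.Exports.

Set Implicit Arguments.
Unset Strict Implicit.
Unset Printing Implicit Defensive.

Local Open Scope classical_set_scope.
Local Open Scope ring_scope.

(* The library norm on ['rV[R]_d] is the sup norm, so Euclidean norms and balls
   are defined here.  Both norms induce the same topology, the same notion of
   (Frechet) differentiability and the same differential: for those, the library
   notions on ['rV[R]_d] are used as they are.  R^m x R^m is represented by
   ['rV[R]_(m + m)] through [row_mx], so it carries the Euclidean norm of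
   R^(2m). *)
Definition enorm (R : realType) (d : nat) (x : 'rV[R]_d) : R :=
  Num.sqrt (\sum_(i < d) x ord0 i ^+ 2).

Definition eball (R : realType) (d : nat) (c : 'rV[R]_d) (r : R) :
  set 'rV[R]_d := [set y | enorm (y - c) < r].

Definition gradient (R : realType) (d : nat) (f : 'rV[R]_d -> R)
    (x : 'rV[R]_d) : 'rV[R]_d :=
  \row_(i < d) 'D_(delta_mx ord0 i) f x.

Definition C1_fun (R : realType) (d : nat) (f : 'rV[R]_d -> R) : Prop :=
  (forall x, differentiable f x) /\ continuous (gradient f).

(* [0, eta), where eta may be +oo *)
Definition KL_dom (R : realType) (eta : \bar R) : set R :=
  [set t | 0 <= t /\ (t%:E < eta)%E].

(* The class Theta_eta; phi : R -> R is unconstrained outside [0, eta), and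
   concavity of phi is convexity of its opposite. *)
Record desingularizing (R : realType) (eta : \bar R) (phi : R -> R) : Prop := {
  desing_ge0 : forall t, KL_dom eta t -> 0 <= phi t;
  desing_concave : @convex_function R R^o (KL_dom eta) (fun t => - phi t);
  desing_continuous : {within KL_dom eta, continuous phi};
  desing_0 : phi 0 = 0;
  desing_C1 : forall t, 0 < t -> (t%:E < eta)%E ->
    derivable phi t 1 /\ {for t, continuous (derive1 phi)};
  desing_deriv_gt0 : forall t, 0 < t -> (t%:E < eta)%E -> 0 < derive1 phi t
}.

(* A differentiable f satisfies the Kurdyka-Lojasiewicz property at xbar when
   [KL_with f xbar eta U phi] holds for some eta, U and phi. *)
Record KL_with (R : realType) (d : nat) (f : 'rV[R]_d -> R) (xbar : 'rV[R]_d)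
    (eta : \bar R) (U : set 'rV[R]_d) (phi : R -> R) : Prop := {
  KL_eta_gt0 : (0 < eta)%E;
  KL_nbhs : nbhs xbar U;
  KL_desing : desingularizing eta phi;
  KL_ineq : forall x, U x -> f xbar < f x ->
    ((f x)%:E < (f xbar)%:E + eta)%E ->
    1 <= derive1 phi (f x - f xbar) * enorm (gradient f x)
}.

(* Main.v *)
(* Put r_n = F(z_n) - F(zstar) and d_n = |x_{n+1} - x_n|.  Concavity of phi gives
   phi(r_n) - phi(r_{n+1}) >= phi'(r_n) (r_n - r_{n+1}); together with (H1), (H2)
   and the KL inequality this yields
   a d_n^2 <= b (d_n + d_{n-1}) (phi(r_n) - phi(r_{n+1})), whence by AM-GM
   2 d_n <= d_{n-1} + 9b/(4a) (phi(r_n) - phi(r_{n+1})).  This telescopes to a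
   uniform bound on the length of (x_n), which keeps z_n in B(zstar, rho) by
   induction and makes (x_n) convergent.  At the limit the gradient vanishes, so
   the KL inequality excludes F(zbar) > F(zstar). *)

From HB Require Import structures.
Require Import Defs.
From mathcomp Require Import ring lra.

Local Open Scope classical_set_scope.
Local Open Scope ring_scope.

(** * The Euclidean norm and the Cauchy-Schwarz inequality *)

Lemma enorm_ge0 {R : realType} {d : nat} (x : 'rV[R]_d) : 0 <= enorm x.
Proof. exact: sqrtr_ge0. Qed.

Lemma enorm0 {R : realType} {d : nat} : enorm (0 : 'rV[R]_d) = 0.
Proof. by rewrite /enorm big1 ?sqrtr0// => i _; rewrite mxE expr0n. Qed.

Lemma sqr_enorm {R : realType} {d : nat} (x : 'rV[R]_d) :
  enorm x ^+ 2 = \sum_(i < d) x ord0 i ^+ 2.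
Proof. by rewrite sqr_sqrtr// sumr_ge0// => i _; rewrite sqr_ge0. Qed.

Lemma enorm_distC {R : realType} {d : nat} (x y : 'rV[R]_d) :
  enorm (x - y) = enorm (y - x).
Proof.
by congr Num.sqrt; apply: eq_bigr => i _; rewrite !mxE -sqrrN opprB.
Qed.

Lemma enorm_eq0 {R : realType} {d : nat} (x : 'rV[R]_d) :
  enorm x = 0 -> x = 0.
Proof.
move=> x0; apply/rowP => i; rewrite mxE.
have /psumr_eq0P : \sum_(i < d) x ord0 i ^+ 2 = 0 by rewrite -sqr_enorm x0 expr0n.
by move=> /(_ (fun=> fun=> sqr_ge0 _) i isT)/eqP; rewrite sqrf_eq0 => /eqP.
Qed.

Lemma cauchy_schwarz {R : realType} {d : nat} (x y : 'rV[R]_d) :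
  \sum_(i < d) x ord0 i * y ord0 i <= enorm x * enorm y.
Proof.
have [/enorm_eq0 ->|x0] := eqVneq (enorm x) 0.
  by rewrite enorm0 mul0r big1// => i _; rewrite mxE mul0r.
have [/enorm_eq0 ->|y0] := eqVneq (enorm y) 0.
  by rewrite enorm0 mulr0 big1// => i _; rewrite mxE mulr0.
set p := enorm x in x0 *; set q := enorm y in y0 *.
have p0 : 0 < p by rewrite lt_neqAle eq_sym x0 enorm_ge0.
have q0 : 0 < q by rewrite lt_neqAle eq_sym y0 enorm_ge0.
(* For [p = |x|] and [q = |y|], this sum of squares expands to [2pq (pq - <x, y>)], and [pq > 0]. *)
have : 0 <= \sum_(i < d) (q * x ord0 i - p * y ord0 i) ^+ 2.
  by apply: sumr_ge0 => i _; rewrite sqr_ge0.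
have -> : \sum_(i < d) (q * x ord0 i - p * y ord0 i) ^+ 2 =
    2 * (p * q) * (p * q - \sum_(i < d) x ord0 i * y ord0 i).
  transitivity (q ^+ 2 * \sum_(i < d) x ord0 i ^+ 2 +
      p ^+ 2 * \sum_(i < d) y ord0 i ^+ 2 -
      2 * (p * q) * \sum_(i < d) x ord0 i * y ord0 i).
    by rewrite !mulr_sumr -big_split -sumrB; apply: eq_bigr => i _ /=; ring.
  by rewrite -!sqr_enorm -/p -/q; ring.
by rewrite pmulr_rge0 ?mulr_gt0// subr_ge0.
Qed.

Lemma ler_enormD {R : realType} {d : nat} (x y : 'rV[R]_d) :
  enorm (x + y) <= enorm x + enorm y.
Proof.
rewrite -(@ler_pXn2r _ 2)// ?nnegrE ?addr_ge0 ?enorm_ge0//.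
rewrite sqr_enorm sqrrD !sqr_enorm.
have -> : \sum_(i < d) (x + y) ord0 i ^+ 2 = \sum_(i < d) x ord0 i ^+ 2 +
    \sum_(i < d) x ord0 i * y ord0 i *+ 2 + \sum_(i < d) y ord0 i ^+ 2.
  by rewrite -!big_split; apply: eq_bigr => i _ /=; rewrite mxE sqrrD.
by rewrite lerD2r lerD2l sumrMnl lerMn2r cauchy_schwarz orbT.
Qed.

Lemma ler_enorm_dist {R : realType} {d : nat} (y x z : 'rV[R]_d) :
  enorm (x - z) <= enorm (x - y) + enorm (y - z).
Proof. by rewrite -[x - z](subrKA y) ler_enormD. Qed.

(** * Euclidean estimates and convergence *)

Lemma normr_le_enorm {R : realType} {d : nat} (x : 'rV[R]_d) :
  `|x| <= enorm x.
Proof.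
rewrite [leLHS]/Num.Def.normr /= mx_normrE; apply: bigmax_le => [|[i j] _ /=].
  exact: enorm_ge0.
rewrite ord1 -sqrtr_sqr ler_wsqrtr// (bigD1 j)//= lerDl sumr_ge0// => k _.
exact: sqr_ge0.
Qed.

Lemma continuous_enorm {R : realType} {d : nat} : continuous (@enorm R d).
Proof.
move=> x; apply: continuous_comp; last exact: sqrt_continuous.
apply: (@continuous_big R^o) => [|i _]; first exact: add_continuous.
move=> y; apply: (@continuous_comp _ _ _ (fun M : 'rV[R]_d => M ord0 i)
    (fun r : R => r ^+ 2)).
  exact: coord_continuous.
exact: exprn_continuous.
Qed.

Lemma cvg_enorm_dist {R : realType} {d : nat} {u : nat -> 'rV[R]_d}
    {l : 'rV[R]_d} (p : 'rV[R]_d) :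
  u n @[n --> \oo] --> l -> enorm (u n - p) @[n --> \oo] --> enorm (l - p).
Proof.
move=> ul; apply: (@continuous_cvg _ _ _ _ _ (fun n => u n - p) (@enorm R d)).
  exact: continuous_enorm.
exact: cvgB ul (cvg_cst _).
Qed.

Lemma cvg_enorm0 {R : realType} {d : nat} (u : nat -> 'rV[R]_d)
    (l : 'rV[R]_d) (e : nat -> R) :
  (forall n, enorm (u n - l) <= e n) -> e n @[n --> \oo] --> 0 ->
  u n @[n --> \oo] --> l.
Proof.
move=> ule e0; apply/subr_cvg0; apply: norm_cvg0.
apply: squeeze_cvgr (cvg_cst (0 : R)) e0.
by apply: nearW => n; rewrite normr_ge0 (le_trans (normr_le_enorm _)).
Qed.

(** The telescoping series of [x] converges absolutely, since the sup norm of each increment is at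
    most its Euclidean norm; completeness concludes. *)
Lemma finite_length_cvg {R : realType} {d : nat} (x : nat -> 'rV[R]_d) :
  cvgn (series (fun n => enorm (x n.+1 - x n))) -> cvgn x.
Proof.
move=> cx; pose V : completeNormedModType R := HB.pack 'rV[R]_d.
have cS : cvgn (series (telescope (x : nat -> V))).
  apply: normed_cvg; apply: series_le_cvg cx => n.
  - exact: normr_ge0.
  - exact: enorm_ge0.
  - exact: normr_le_enorm.
rewrite (_ : x = fun n => x 0%N + series (telescope x) n).
  have /cvg_ex[l Sl] := cS; apply/cvg_ex; exists (x 0%N + l).
  by apply: (@cvgD _ V _ _ _ (fun=> x 0%N) _ (x 0%N)) Sl; exact: cvg_cst.
by apply/funext => n; exact: eq_sum_telescope.
Qed.

(** * Concavity, the KL inequality and the recursion for the step lengths *)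

(* Left difference quotients at [t] are bounded by the slope of the chord from
   [s] to [t]. *)
Lemma concave_tangent {R : realType} {D : set R} {phi : R -> R} {s t : R} :
  @convex_function R R^o D (fun u => - phi u) -> D s -> D t ->
  derivable phi t 1 -> s <= t ->
  derive1 phi t * (t - s) <= phi t - phi s.
Proof.
move=> cvx Ds Dt dphi; rewrite le_eqVlt => /predU1P[->|st].
  by rewrite !subrr mulr0.
have ts0 : 0 < t - s by rewrite subr_gt0.
rewrite -ler_pdivlMr//.
have cvgL : h^-1 *: (phi (h + t) - phi t) @[h --> 0^'-] --> derive1 phi t.
  apply: cvg_dnbhs_at_left; rewrite derive1E.
  have := dphi; rewrite /derivable /derive.
  set f := (fun h => _); set g := (X in _ -> X @ _ --> _).
  suff -> : f = g by [].
  by apply/funext => h; rewrite /f /g /= [h%:A]mulr1.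
apply: cvgr_to_le cvgL _; near=> h.
have h0 : h < 0 by near: h; exact: nbhs_left_lt.
have hs : s - t < h by near: h; apply: nbhs_left_gt; rewrite subr_lt0.
(* This is the weight of [s] when [h + t] is written as a convex combination of [s] and [t]. *)
have l01 : 0 <= - h / (t - s) <= 1.
  by rewrite divr_ge0 ?oppr_ge0 ?(ltW h0) ?(ltW ts0)//= ler_pdivrMr// mul1r; lra.
pose l : {i01 R} := Itv01 (andP l01).1 (andP l01).2.
set k := - h / (t - s) in l01 l.
have cvxh : - phi (k * s + (1 - k) * t) <= k * - phi s + (1 - k) * - phi t.
  by apply: (cvx l); rewrite inE.
have ks : k * s + (1 - k) * t = h + t by rewrite /k; field; rewrite gt_eqF.
have hQ : h * ((phi t - phi s) / (t - s)) = k * (phi s - phi t).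
  by rewrite /k; field; rewrite gt_eqF.
rewrite ks in cvxh.
(* Dividing by [h < 0] reverses the concavity inequality into an upper bound. *)
rewrite [_ *: _]/(_ * _) ler_ndivrMl// hQ; lra.
Unshelve. all: by end_near. Qed.

(** The extra [d N] on the left closes the induction: the inequality at [N + 1] trades it for
    [2 * d N.+1], one copy joining the sum and one carried on. *)
Lemma sum_contraction_le {R : realDomainType} (K : R) (d p : nat -> R) N :
  (forall n, (1 <= n <= N)%N -> 2 * d n <= d n.-1 + K * (p n - p n.+1)) ->
  \sum_(0 <= n < N.+1) d n + d N <= 2 * d 0%N + K * (p 1%N - p N.+1).
Proof.
elim: N => [|N IH] dK; first by rewrite big_nat1; lra.
rewrite big_nat_recr//=.
have := dK N.+1; rewrite leqnn => /(_ isT) /=.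
suff : \sum_(0 <= n < N.+1) d n + d N <= 2 * d 0%N + K * (p 1%N - p N.+1).
  lra.
by apply: IH => n /andP[n1 nN]; apply: dK; rewrite n1 leqW.
Qed.

Lemma KL_dom_gap {R : realType} (eta : \bar R) (u l : R) :
  l <= u -> (u%:E < l%:E + eta)%E -> KL_dom eta (u - l).
Proof.
move=> lu ueta; split; first by rewrite subr_ge0.
by rewrite EFinB lteBlDl.
Qed.

(** The tangent inequality is taken at the right endpoint [t > 0], where the derivative is positive,
    so [s = 0] is covered. *)
Lemma desingularizing_le {R : realType} {eta : \bar R} {phi : R -> R} {s t : R} :
  desingularizing eta phi -> KL_dom eta s -> KL_dom eta t -> s <= t ->
  phi s <= phi t.
Proof.
move=> dphi Ds Dt; rewrite le_eqVlt => /predU1P[->//|st].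
have t0 : 0 < t by apply: le_lt_trans st; case: Ds.
have [dt _] := desing_C1 dphi t0 Dt.2.
have := concave_tangent (desing_concave dphi) Ds Dt dt (ltW st).
have := mulr_gt0 (desing_deriv_gt0 dphi t0 Dt.2) (_ : 0 < t - s).
by rewrite subr_gt0 => /(_ st); lra.
Qed.

(** Here [p], [q] stand for z_n, z_{n+1} and [t], [s] for d_n, d_{n-1}. The factor 9/4 is the
    maximum of [(t + s)(2t - s) / t^2] over [s], reached at [s = t/2]. *)
Lemma KL_descent_step {R : realType} {d : nat} {f : 'rV[R]_d -> R}
    {xbar : 'rV[R]_d} {eta : \bar R} {U : set 'rV[R]_d} {phi : R -> R}
    {a b : R} {p q : 'rV[R]_d} {s t : R} :
  KL_with f xbar eta U phi -> 0 < a -> 0 < b -> 0 <= s -> 0 <= t ->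
  U p -> f xbar <= f q -> ((f p)%:E < (f xbar)%:E + eta)%E ->
  a * t ^+ 2 <= f p - f q -> enorm (gradient f p) <= b * (t + s) ->
  2 * t <= s + 9 * b / (4 * a) * (phi (f p - f xbar) - phi (f q - f xbar)).
Proof.
move=> KL a0 b0 s0 t0 Up xq peta dec grad.
have qp : f q <= f p.
  by rewrite -subr_ge0 (le_trans _ dec)// mulr_ge0 ?sqr_ge0// ltW.
have [xp|px] := ltP (f xbar) (f p); last first.
  have t2 : a * t ^+ 2 <= 0 by lra.
  have : t ^+ 2 <= 0 by rewrite -(pmulr_rle0 _ a0).
  rewrite le_eqVlt ltNge sqr_ge0 orbF sqrf_eq0 => /eqP ->.
  by rewrite (_ : f p = f q); lra.
have dphi := KL_desing KL.
have Dp : KL_dom eta (f p - f xbar) by apply: KL_dom_gap => //; exact: ltW.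
have Dq : KL_dom eta (f q - f xbar).
  by apply: KL_dom_gap => //; apply: le_lt_trans peta; rewrite lee_fin.
have r0 : 0 < f p - f xbar by rewrite subr_gt0.
have [drv _] := desing_C1 dphi r0 Dp.2.
have := concave_tangent (desing_concave dphi) Dq Dp drv (lerB qp (lexx _)).
have := KL_ineq KL Up xp peta.
have := desing_deriv_gt0 dphi r0 Dp.2.
move: (derive1 phi _ : R) (phi (f q - _)) (phi (f p - _)) => P v u P0 KLp tan.
set D := u - v.
have Pts : 1 <= P * (b * (t + s)) by rewrite (le_trans KLp)// ler_pM2l.
have ts0 : 0 < t + s.
  rewrite lt_neqAle addr_ge0// andbT eq_sym; apply/negP => /eqP ts.
  by move: Pts; rewrite ts !mulr0 ler10.
have PD : P * (f p - f q) <= D.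
  by move: tan; rewrite opprB addrA subrK.
(* Multiply [f p - f q] by [P * (b * (t + s)) >= 1], then apply the tangent bound [PD]. *)
have aD : a * t ^+ 2 <= b * (t + s) * D.
  rewrite (le_trans dec)// (@le_trans _ _ (b * (t + s) * (P * (f p - f q))))//.
    by rewrite mulrA ler_peMl ?subr_ge0// mulrC.
  by rewrite ler_pM2l// mulr_gt0.
have key : 9 / 4 * t ^+ 2 <= (t + s) * (9 * b / (4 * a) * D).
  have -> : 9 / 4 * t ^+ 2 = 9 / (4 * a) * (a * t ^+ 2).
    by field; rewrite gt_eqF.
  have -> : (t + s) * (9 * b / (4 * a) * D) = 9 / (4 * a) * (b * (t + s) * D).
    by field; rewrite gt_eqF.
  by rewrite ler_pM2l// divr_gt0// mulr_gt0.
(* Otherwise [9/4 t^2 < (t + s)(2t - s)], that is, [(t/2 - s)^2 < 0]. *)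
rewrite leNgt; apply/negP => lt2.
have : (t + s) * (9 * b / (4 * a) * D) < (t + s) * (2 * t - s).
  by rewrite ltr_pM2l//; lra.
move=> /(le_lt_trans key); rewrite ltNge => /negP; apply.
have := sqr_ge0 (t / 2 - s); nra.
Qed.

(** * Length of the trajectory, confinement to the ball and passage to the limit *)

Lemma enorm_dist_le_length {R : realType} {d : nat} (x : nat -> 'rV[R]_d) n :
  enorm (x n - x 0%N) <= \sum_(0 <= k < n) enorm (x k.+1 - x k).
Proof.
elim: n => [|n IH]; first by rewrite subrr enorm0 big_geq.
rewrite big_nat_recr//= addrC (le_trans (ler_enorm_dist (x n) _ _))//.
by rewrite lerD2l.
Qed.

Theorem lemma3 (R : realType) (m : nat) (a b c1 c2 : R)
  (ha : 0 < a) (hb : 0 < b) (hc1 : 0 <= c1) (hc2 : 0 <= c2)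
  (hc : c1 ^+ 2 + c2 ^+ 2 != 0)
  (F : 'rV[R]_(m + m) -> R) (hF : C1_fun F)
  (xstar : 'rV[R]_m) (zstar : 'rV[R]_(m + m))
  (hzstar : zstar = row_mx xstar xstar)
  (eta : \bar R) (U : set 'rV[R]_(m + m)) (phi : R -> R)
  (hKL : KL_with F zstar eta U phi)
  (sigma rho : R) (hrho : 0 < rho) (hsigma : rho < sigma)
  (hU : eball zstar sigma `<=` U)
  (x v w : nat -> 'rV[R]_m) (z : nat -> 'rV[R]_(m + m))
  (hz : forall n, z n = row_mx (v n) (w n))
  (H1 : forall n, a * enorm (x n.+1 - x n) ^+ 2 <= F (z n) - F (z n.+1))
  (H2 : forall n, (1 <= n)%N ->
    enorm (gradient F (z n)) <=
      b * (enorm (x n.+1 - x n) + enorm (x n - x n.-1)))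
  (H3 : forall n, (1 <= n)%N -> forall y : 'rV[R]_m,
    enorm (z n - row_mx y y) <=
      c1 * enorm (x n - y) + c2 * enorm (x n.-1 - y))
  (Hstep : forall n, eball zstar rho (z n) ->
    eball zstar sigma (z n.+1) /\ F zstar <= F (z n.+1))
  (hz0 : eball zstar rho (z 0%N))
  (hF0 : F zstar <= F (z 0%N))
  (hF0eta : ((F (z 0%N))%:E < (F zstar)%:E + eta)%E)
  (hinit : enorm (xstar - x 0%N)
           + 2 * Num.sqrt ((F (z 0%N) - F zstar) / a)
           + 9 * b / (4 * a) * phi (F (z 0%N) - F zstar)
           < rho / (c1 + c2)) :
  (forall n, eball zstar rho (z n)) /\
  (\sum_(1 <= n <oo) (enorm (x n - x n.-1))%:E < +oo)%E /\
  exists xbar : 'rV[R]_m,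
    let zbar := row_mx xbar xbar in
    [/\ x n @[n --> \oo] --> xbar,
        z n @[n --> \oo] --> zbar,
        eball zstar sigma zbar,
        gradient F zbar = 0 &
        F (z n) @[n --> \oo] --> F zbar /\ F zbar = F zstar].
Proof.
set K := 9 * b / (4 * a) in hinit; set Q := Num.sqrt _ in hinit.
have [F_diff gradF_cont] := hF; have dphi := KL_desing hKL.
pose len n := enorm (x n.+1 - x n).
have len0 n : 0 <= len n := enorm_ge0 _.
have S0 : 0 < c1 + c2.
  rewrite lt_neqAle addr_ge0// andbT eq_sym paddr_eq0//.
  by apply: contra hc => /andP[/eqP -> /eqP ->]; rewrite expr0n addr0.
have K0 : 0 < K by rewrite divr_gt0 ?mulr_gt0.
have F_decr n : F (z n.+1) <= F (z n).
  by rewrite -subr_ge0 (le_trans _ (H1 n))// mulr_ge0 ?sqr_ge0// ltW.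
have F_le0 n : F (z n) <= F (z 0%N).
  by elim: n => // n; exact: le_trans.
have Feta n : ((F (z n))%:E < (F zstar)%:E + eta)%E.
  by apply: le_lt_trans hF0eta; rewrite lee_fin.
have rhosub p : eball zstar rho p -> U p.
  by move=> /= pr; apply: hU; exact: lt_trans hsigma.
pose M := 2 * Q + K * phi (F (z 0%N) - F zstar).
have dom n : F zstar <= F (z n) -> KL_dom eta (F (z n) - F zstar).
  by move=> Fn; exact: KL_dom_gap.
(* Only z_0, ..., z_n need to lie in the ball: [Hstep] supplies [F zstar <= F (z n.+1)], so the
   bound already includes the step to x_{n+1}. *)
have length_le n : (forall k, (k <= n)%N -> eball zstar rho (z k)) ->
    \sum_(0 <= k < n.+1) len k <= M.
  move=> zin.
  have Fge k : (k <= n)%N -> F zstar <= F (z k.+1) by move=> /zin/Hstep[].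
  have := @sum_contraction_le _ K len (fun k => phi (F (z k) - F zstar)) n.
  have Q0 : len 0%N <= Q.
    rewrite -[len 0%N]ger0_norm// -sqrtr_sqr ler_wsqrtr// ler_pdivlMr// mulrC.
    by rewrite (le_trans (H1 0%N))// lerD2l lerN2 Fge.
  (* The recursion starts at index 1, so the telescoped sum begins with [phi] at [z 1]; monotonicity
     replaces it by the value at [z 0]. *)
  have phi1 : phi (F (z 1%N) - F zstar) <= phi (F (z 0%N) - F zstar).
    apply: (desingularizing_le dphi); [exact/dom/Fge|exact: dom|].
    by rewrite lerD2r.
  have phin : 0 <= phi (F (z n.+1) - F zstar).
    by apply: (desing_ge0 dphi); exact/dom/Fge.
  move=> /(_ _)/wrap[k /andP[k1 kn]|].
    case: k k1 kn => // k _ kn.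
    apply: (KL_descent_step hKL) => //.
    - exact/rhosub/zin.
    - exact: Fge.
    - exact: H1.
    - exact: H2.
  have : K * (phi (F (z 1%N) - F zstar) - phi (F (z n.+1) - F zstar)) <=
      K * phi (F (z 0%N) - F zstar).
    by rewrite ler_pM2l// (le_trans _ phi1)// gerDl oppr_le0.
  have := len0 n; rewrite /M; lra.
have x_near n : \sum_(0 <= k < n) len k <= M ->
    enorm (x n - xstar) < rho / (c1 + c2).
  move=> nM; rewrite (le_lt_trans (ler_enorm_dist (x 0%N) _ _))//.
  rewrite (enorm_distC _ xstar) (le_lt_trans _ hinit)//.
  by have := enorm_dist_le_length x n; rewrite -/len /M in nM *; lra.
(* By (H3) at [xstar], z_{n+1} is controlled by x_{n+1} and x_n, both within [rho / (c1 + c2)] of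
   [xstar]. *)
have z_in n : forall k, (k <= n)%N -> eball zstar rho (z k).
  elim: n => [k|n IH k]; first by rewrite leqn0 => /eqP ->.
  rewrite leq_eqVlt => /predU1P[->|]; last exact: IH.
  have nM := length_le n IH.
  have xn1 := x_near n.+1 nM.
  have xn : enorm (x n - xstar) < rho / (c1 + c2).
    by apply: x_near; move: nM; rewrite big_nat_recr//=; have := len0 n; lra.
  rewrite /eball /= hzstar (le_lt_trans (H3 _ _ _))//=.
  have -> : rho = c1 * (rho / (c1 + c2)) + c2 * (rho / (c1 + c2)).
    by field; rewrite gt_eqF.
  (* Strictness must come from a term with positive coefficient: the second if [c1 = 0], else the
     first. *)
  have [c10|c10] := eqVneq c1 0.
    rewrite c10 !mul0r !add0r ltr_pM2l//; last by rewrite c10 add0r in S0.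
    by rewrite c10 add0r in xn.
  apply: ltr_leD; first by rewrite ltr_pM2l// lt_neqAle eq_sym c10.
  by rewrite ler_wpM2l// ltW.
have z_ball n : eball zstar rho (z n) by apply: (z_in n).
have lengthM n : \sum_(0 <= k < n) len k <= M.
  have := length_le n (z_in n); rewrite big_nat_recr//=.
  by have := len0 n; lra.
have cvg_len : cvgn (series len).
  apply: nondecreasing_is_cvgn; first exact: nondecreasing_series.
  by exists M => _ [n _ <-]; exact: lengthM.
split=> //; split.
  apply: (@le_lt_trans _ _ M%:E); last exact: ltry.
  apply: (@lime_le _ \oo _ R M%:E (fun n =>
      \sum_(1 <= k < n) (enorm (x k - x k.-1))%:E)%E).
    apply: is_cvg_ereal_nneg_natsum_cond => n _ _; exact: enorm_ge0.
  apply: nearW => n; rewrite sumEFin lee_fin big_add1.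
  exact: lengthM.
have /cvg_ex[xbar xbarP] := finite_length_cvg _ cvg_len.
have len_cvg0 : len n @[n --> \oo] --> 0 := cvg_series_cvg_0 cvg_len.
have dist0 : enorm (x n - xbar) @[n --> \oo] --> 0.
  by have := cvg_enorm_dist xbar xbarP; rewrite subrr enorm0.
exists xbar => zbar.
have z_cvg : z n @[n --> \oo] --> zbar.
  (* Shift by one, as (H3) holds from index 1 on. *)
  rewrite -cvg_shiftS.
  apply: (@cvg_enorm0 _ _ _ _ (fun n =>
    c1 * enorm (x n.+1 - xbar) + c2 * enorm (x n - xbar))).
    by move=> n; exact: H3.
  rewrite (_ : 0 = c1 * 0 + c2 * 0 :> R); last by rewrite !mulr0 addr0.
  apply: cvgD; apply: cvgM => //; [exact: cvg_cst| |exact: cvg_cst].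
  by rewrite (cvg_shiftS (fun n => enorm (x n - xbar))).
have zbar_in : eball zstar sigma zbar.
  (* The limit is only known to lie in the closed ball of radius [rho], hence in the open one of
     radius [sigma]. *)
  apply: le_lt_trans hsigma.
  apply: cvgr_to_le (cvg_enorm_dist zstar z_cvg) _; apply: nearW => n.
  exact/ltW/z_ball.
have grad_cvg : gradient F (z n) @[n --> \oo] --> gradient F zbar.
  apply: (@continuous_cvg _ _ _ _ _ z (gradient F)) => //.
  exact: gradF_cont.
have grad0 : gradient F zbar = 0.
  suff : gradient F (z n) @[n --> \oo] --> (0 : 'rV[R]_(m + m)).
    exact: (cvg_unique _ grad_cvg).
  rewrite -cvg_shiftS.
  apply: (@cvg_enorm0 _ _ _ _ (fun n => b * (len n.+1 + len n))).
    by move=> n; rewrite subr0; exact: H2.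
  rewrite (_ : 0 = b * (0 + 0) :> R); last by rewrite addr0 mulr0.
  apply: cvgM; [exact: cvg_cst|apply: cvgD => //].
  by rewrite (cvg_shiftS len).
have F_cvg : F (z n) @[n --> \oo] --> F zbar.
  apply: (@continuous_cvg _ _ _ _ _ z F) => //.
  exact: differentiable_continuous.
split=> //; split=> //; apply/eqP; rewrite eq_le; apply/andP; split; last first.
  (* Every [F (z n)] is at least [F zstar]: by [hF0] at index 0, by [Hstep] afterwards. *)
  apply: cvgr_to_ge F_cvg _; apply: nearW => -[|n]//.
  by have [] := Hstep _ (z_ball n).
rewrite leNgt; apply/negP => Fbar.
(* This keeps [F zbar] below [F zstar + eta], as the KL inequality at [zbar] requires. *)
have Fbar0 : F zbar <= F (z 0%N).
  by apply: cvgr_to_le F_cvg _; exact: nearW.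
have := KL_ineq hKL (hU _ zbar_in) Fbar (_ : _).
rewrite grad0 enorm0 mulr0 ler10 => /(_ _)/wrap[|//].
by apply: le_lt_trans hF0eta; rewrite lee_fin.
Qed.
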